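(* Let $\{P_n(x)\}_{n\ge 0}$ be a sequence of polynomials with complex coefficients with $\deg P_n=n$, let $a$ be a constant, let $m,n\ge0$ be integers, and let $\rho_{j,n}^m$ ($0\le j\le m+n+1$) be the coefficients defined by $$\int_{-a}^{x+a}P_m(x-t)P_n(t)\,dt=\sum_{j=0}^{m+n+1}\rho_{j,n}^m P_j(x+a).$$ For $0\le j\le m+n+1$, the coefficients can be expressed as $$\rho_{j,n}^m=\sum_{p=j}^{m+n+1}\frac{b_{p,j}}{p!}\sum_{\nu=1}^p\left(\left.\frac{d^{p-\nu}P_m}{dx^{p-\nu}}\right|_{x=-a}\left.\frac{d^{\nu-1}P_n}{dx^{\nu-1}}\right|_{x=-a}\right),$$ or, equivalently, $$\rho_{j,n}^m=\sum_{\nu=\max(1,j-n)}^{m+1}\gamma_{n-j+\nu,0}^{(j-\nu,j)}\left.\frac{d^{\nu-1}P_m}{dx^{\nu-1}}\right|_{x=-a}\qquad\text{for } j\ge m+1,$$ and $$\rho_{j,n}^m=\sum_{\nu=1}^{j}\gamma_{m-j+\nu,0}^{(j-\nu,j)}\left.\frac{d^{\nu-1}P_n}{dx^{\nu-1}}\right|_{x=-a}+\sum_{\nu=j+1}^{n+1}\left(\left.\frac{d^{\nu-1}P_n}{dx^{\nu-1}}\right|_{x=-a}\sum_{p=0}^m\frac{b_{p+\nu,j}}{(p+\nu)!}\left.\frac{d^{p}P_m}{dx^{p}}\right|_{x=-a}\right)\qquad\text{for }0\le j\le m.$$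
   Context: Connection coefficients: for integers $N\ge r\ge0$ and $s\ge0$, the numbers $\gamma_{N-r,k}^{(r,s)}$ are the unique ones with $$\frac{d^r P_N(x)}{dx^r}=\sum_{k=0}^{N-r}\gamma_{N-r,k}^{(r,s)}\,\frac{d^sP_{k+s}(x)}{dx^s},$$ (so $\gamma_{N',k}^{(r,s)}$ refers to the $r$-th derivative of $P_{N'+r}$), and the numbers $b_{N,k}$ are the unique ones with $(x+a)^N=\sum_{k=0}^N b_{N,k}P_k(x)$ for $N\ge0$. These exist and are unique because $\deg P_N=N$. Empty sums are zero. No orthogonality is assumed. *)

(* Defs.v *)
From HB Require Import structures.
From mathcomp Require Import all_boot all_order all_algebra.
From mathcomp Require Import all_classical all_reals all_analysis.
From mathcomp Require Import complex.

Set Implicit Arguments.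
Unset Strict Implicit.
Unset Printing Implicit Defensive.

Import Order.TTheory GRing.Theory Num.Theory.
Local Open Scope ring_scope.
Local Open Scope complex_scope.

(* The integral of f along the straight segment from z to w, via u |->
   z + u (w - z) for u in [0, 1]. For real z and w it is the usual oriented
   integral from z to w; for polynomial f it does not depend on the path. *)
Definition segment_integral (R : realType) (f : R[i] -> R[i]) (z w : R[i]) :
    R[i] :=
  let g (u : R) := f (z + u%:C * (w - z)) * (w - z) in
  (\int[lebesgue_measure]_(u in `[0%R, 1%R]) complex.Re (g u)) +i*
  (\int[lebesgue_measure]_(u in `[0%R, 1%R]) complex.Im (g u)).

(* gamma r s M k stands for $\gamma_{M,k}^{(r,s)}$: the lower index M is the
   degree N - r of the r-th derivative of P_N, not N itself. The condition
   determines gamma r s M k for k <= M and leaves it free for k > M. *)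
Definition connection_coefficients (R : realType) (P : nat -> {poly R[i]})
    (gamma : nat -> nat -> nat -> nat -> R[i]) : Prop :=
  forall N r s : nat, (r <= N)%N ->
    (P N)^`(r) =
      \sum_(0 <= k < (N - r).+1) gamma r s (N - r)%N k *: (P (k + s)%N)^`(s).

Definition shifted_power_coefficients (R : realType) (P : nat -> {poly R[i]})
    (a : R[i]) (b : nat -> nat -> R[i]) : Prop :=
  forall N : nat, ('X + a%:P) ^+ N = \sum_(0 <= k < N.+1) b N k *: P k.

Definition convolution_coefficients (R : realType) (P : nat -> {poly R[i]})
    (a : R[i]) (m n : nat) (rho : nat -> R[i]) : Prop :=
  forall x : R[i],
    segment_integral (fun t => (P m).[x - t] * (P n).[t]) (- a) (x + a) =
    \sum_(0 <= j < (m + n + 1).+1) rho j * (P j).[x + a].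

(* Main.v *)
(** With [y = x + a] and divided powers [u^[k] = u^k / k!], Taylor expansion of
    both factors at [-a] and the beta integral
    [int_(-a)^y (t + a)^[i] (y - t)^[k] dt = (y + a)^[i + k + 1]] turn
    the convolution into
    [sum_(i, k) P_m^(k)(-a) P_n^(i)(-a) (y + a)^[i + k + 1]], and expanding the
    powers of [y + a] in the basis [P_j] gives
    [rho_j = sum_(i, k) P_m^(k)(-a) P_n^(i)(-a) b_(i+k+1, j) / (i+k+1)!].
    The first formula groups this double sum by antidiagonals. For the other
    two, the inner sum over one index, with [nu - 1] the other one and
    [nu <= j], is a connection coefficient: the [(j - nu)]-th derivative of
    [P_N] is the [j]-th derivative of
    [sum_i P_N^(i)(-a) (y + a)^[i + nu]], in which [P_j] has coefficient
    [gamma_(N-j+nu, 0)^(j-nu, j)]. *)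

Require Import Defs.
From HB Require Import structures.
From mathcomp Require Import all_boot all_order all_algebra.
From mathcomp Require Import all_classical all_reals all_analysis.
From mathcomp Require Import complex zify.
Import Order.TTheory GRing.Theory Num.Theory.
Local Open Scope ring_scope.
Local Open Scope complex_scope.

Set Implicit Arguments.
Unset Strict Implicit.

(** * Integrals of polynomials along segments *)

Section RintegralPoly.
Import numFieldNormedType.Exports.

Lemma Rintegral_deriv_poly (R : realType) (p : {poly R}) :
  \int[lebesgue_measure]_(u in `[0%R, 1%R]) p^`().[u] = p.[1] - p.[0].
Proof.
rewrite /Rintegral (@continuous_FTC2 _ _ (horner p)) //.
- by apply: continuous_subspaceT => u; exact: continuous_horner.
- split=> [u _||]; first exact: derivable_horner.
  + by apply: cvg_at_right_filter; exact: continuous_horner.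
  + by apply: cvg_at_left_filter; exact: continuous_horner.
- by move=> u _; rewrite derivE.
Qed.

End RintegralPoly.

(** By the chain rule the integrand is the derivative of [Q] along the parametrised segment. Its
    real and imaginary parts are real polynomials in [u], to which the fundamental theorem
    applies. *)
Lemma segment_integral_deriv (R : realType) (f : R[i] -> R[i])
    (Q : {poly R[i]}) (z w : R[i]) :
  (forall t, f t = Q^`().[t]) -> segment_integral f z w = Q.[w] - Q.[z].
Proof.
move=> fQ; pose h := Q \Po (z%:P + (w - z) *: 'X).
(* [F] is the real or the imaginary part; [FZ] makes applying [F] to coefficients commute with
   evaluation at real points. *)
have part (F : {additive R[i] -> R})
    (FZ : forall (r : R) y, F (y * r%:C) = F y * r) :
    \int[lebesgue_measure]_(u in `[0%R, 1%R]) F (f (z + u%:C * (w - z)) * (w - z))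
    = F Q.[w] - F Q.[z].
  have ev (p : {poly R[i]}) (r : R) : (map_poly F p).[r] = F p.[r%:C].
    elim/poly_ind: p => [|p c IH]; first by rewrite raddf0 !horner0 raddf0.
    rewrite raddfD /= map_polyC /= !hornerE !raddfD /= FZ -IH; congr (_ + _).
    rewrite -hornerMX; congr (_.[_]); apply/polyP => i.
    by rewrite !(coefMX, coef_map) /=; case: (i == 0%N); rewrite ?raddf0.
  have dF (p : {poly R[i]}) : (map_poly F p)^`() = map_poly F p^`().
    by apply/polyP => i; rewrite !(coef_map, coef_deriv) /= raddfMn.
  transitivity (\int[lebesgue_measure]_(u in `[0%R, 1%R]) (map_poly F h)^`().[u]).
    apply: eq_Rintegral => u _; rewrite dF ev deriv_comp fQ; congr (F _).
    rewrite !hornerE horner_comp !hornerE derivD derivC derivZ derivX !hornerE.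
    by rewrite mulrC [_ * u%:C]mulrC /= mulr1 mulrC.
  rewrite (Rintegral_deriv_poly (map_poly F h)) !ev !horner_comp !hornerE /=.
  by rewrite [z + w]addrC addrK.
rewrite /segment_integral.
rewrite (part (@complex.Re R : {additive R[i] -> R})); last first.
  by move=> r [y1 y2] /=; rewrite mulr0 subr0.
rewrite (part (@complex.Im R : {additive R[i] -> R})) //=; last first.
  by move=> r [y1 y2] /=; rewrite mulr0 add0r.
by case: Q.[w] => ? ?; case: Q.[z].
Qed.

(** * Divided powers, Taylor expansion and the beta integral *)

(** The divided power [p^k / k!]. *)
Definition dpow (F : numFieldType) (p : {poly F}) (k : nat) : {poly F} :=
  k`!%:R^-1 *: p ^+ k.

Lemma dpow0 (F : numFieldType) (p : {poly F}) : dpow p 0 = 1.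
Proof. by rewrite /dpow invr1 scale1r. Qed.

Lemma deriv_dpow (F : numFieldType) (p : {poly F}) (k : nat) :
  (dpow p k.+1)^`() = p^`() * dpow p k.
Proof.
rewrite /dpow derivZ deriv_exp -scalerAr -mulrnAr -scaler_nat -scalerAr scalerA.
congr (_ *: _); rewrite factS natrM invfM mulrAC mulVf ?mul1r //.
Qed.

Lemma derivn_dpow (F : numFieldType) (p : {poly F}) (k l : nat) :
  p^`() = 1 -> (dpow p (k + l))^`(l) = dpow p k.
Proof.
by move=> dp; elim: l => [|l IH]; rewrite ?addn0 // addnS derivSn deriv_dpow dp mul1r.
Qed.

Lemma horner_dpow (F : numFieldType) (p : {poly F}) (k : nat) (x : F) :
  (dpow p k).[x] = p.[x] ^+ k / k`!%:R.
Proof. by rewrite /dpow hornerZ horner_exp mulrC. Qed.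

Lemma taylor_dpow (F : numFieldType) (p : {poly F}) (N : nat) (c : F) :
  (size p <= N)%N -> p = \sum_(i < N) p^`(i).[c] *: dpow ('X - c%:P) i.
Proof.
(* Taylor's formula is used over the polynomial ring, at the constant [c] with increment
   ['X - c%:P]. *)
move=> pN; transitivity (p^:P).[c%:P + ('X - c%:P)].
  by rewrite addrC subrK -/(comp_poly _ _) comp_polyXr.
rewrite (@nderiv_taylor_wide _ N); last 2 first.
- exact: mulrC.
- by rewrite size_map_polyC.
apply: eq_bigr => i _; rewrite nderivn_map horner_map nderivn_def hornerMn /=.
rewrite /dpow scalerA mul_polyC; congr (_ *: _).
by rewrite -mulr_natr mulfK // pnatr_eq0 -lt0n fact_gt0.
Qed.

(** Iterated integration by parts: when [p' = 1] and [q' = -1] this is a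
    primitive of [dpow p i * dpow q k]. *)
Fixpoint beta_primitive (F : numFieldType) (p q : {poly F}) (i k : nat) :
    {poly F} :=
  dpow p i.+1 * dpow q k +
  if k is k'.+1 then beta_primitive p q i.+1 k' else 0.

(** For [k = k'.+1], the product rule on the leading term leaves [- dpow p i.+1 * dpow q k'], which
    the recursive call cancels. *)
Lemma deriv_beta_primitive (F : numFieldType) (p q : {poly F}) (i k : nat) :
  p^`() = 1 -> q^`() = - 1 ->
  (beta_primitive p q i k)^`() = dpow p i * dpow q k.
Proof.
move=> dp dq; elim: k i => [|k IH] i /=.
  by rewrite dpow0 addr0 !mulr1 deriv_dpow dp mul1r.
by rewrite derivD derivM !deriv_dpow dp dq IH mul1r mulN1r mulrN subrK.
Qed.

Lemma beta_primitive_start (F : numFieldType) (p q : {poly F}) (i k : nat)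
    (u : F) :
  p.[u] = 0 -> (beta_primitive p q i k).[u] = 0.
Proof.
move=> pu; elim: k i => [|k IH] i /=; rewrite hornerD hornerM horner_dpow pu;
  by rewrite expr0n !mul0r add0r ?horner0 ?IH.
Qed.

(** At a zero of [q] only the last term survives, the one with factor [dpow q 0 = 1]. *)
Lemma beta_primitive_end (F : numFieldType) (p q : {poly F}) (i k : nat)
    (v : F) :
  q.[v] = 0 -> (beta_primitive p q i k).[v] = (dpow p (i + k).+1).[v].
Proof.
move=> qv; elim: k i => [|k IH] i /=; rewrite hornerD hornerM.
  by rewrite dpow0 hornerC mulr1 horner0 addr0 addn0.
by rewrite (horner_dpow q) qv expr0n !mul0r mulr0 add0r IH addSnnS.
Qed.

(** * Uniqueness of polynomial expansions *)

Lemma horner_inj (F : numFieldType) (p q : {poly F}) :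
  (forall x, p.[x] = q.[x]) -> p = q.
Proof.
move=> pq; apply/eqP; rewrite -subr_eq0; apply/eqP.
(* In characteristic zero the naturals give [size (p - q)] distinct roots, too many for a nonzero
   polynomial. *)
apply: (@roots_geq_poly_eq0 _ _ [seq i%:R | i <- iota 0 (size (p - q))]).
- by apply/allP => x _; rewrite rootE hornerD hornerN pq subrr.
- by rewrite map_inj_uniq ?iota_uniq // => i j /eqP; rewrite eqr_nat => /eqP.
- by rewrite size_map size_iota.
Qed.

(** Only the last polynomial reaches the top degree, so its coefficients agree; cancel it and
    induct. *)
Lemma graded_sum_inj (F : fieldType) (Q : nat -> {poly F}) (K : nat)
    (c d : nat -> F) :
  (forall k, size (Q k) = k.+1) ->
  \sum_(k < K) c k *: Q k = \sum_(k < K) d k *: Q k ->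
  forall k, (k < K)%N -> c k = d k.
Proof.
move=> sQ; elim: K => // K IH.
rewrite !big_ord_recr /= => E.
have coefK f : (\sum_(k < K) f k *: Q k)`_K = 0.
  rewrite coef_sum big1 // => i _.
  by rewrite coefZ nth_default ?mulr0 // sQ.
have QK : (Q K)`_K != 0.
  by have := lead_coef_eq0 (Q K); rewrite /lead_coef sQ /= -size_poly_eq0 sQ => ->.
have cdK : c K = d K.
  move/(congr1 (fun p : {poly F} => p`_K)): E.
  by rewrite !coefD !coefK !add0r !coefZ => /(mulIf QK).
move: E; rewrite cdK => /addIr /IH cd k.
by rewrite ltnS leq_eqVlt => /orP[/eqP->|/cd].
Qed.

Lemma size_derivn_nat (F : numFieldType) (p : {poly F}) (s k : nat) :
  size p = (k + s).+1 -> size p^`(s) = k.+1.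
Proof.
move=> sp; apply/eqP; rewrite eqn_leq; apply/andP; split.
  apply/leq_sizeP => i ki; rewrite coef_derivn nth_default ?mul0rn // sp; lia.
rewrite ltnNge; apply/negP => /leq_sizeP /(_ k (leqnn k)) /eqP.
rewrite coef_derivn mulrn_eq0 -leqn0 leqNgt ffact_gt0 leq_addr /= addnC.
by have := lead_coef_eq0 p; rewrite /lead_coef sp /= => ->; rewrite -size_poly_eq0 sp.
Qed.

Lemma derivn_sum (R : nzRingType) (I : Type) (r : seq I)
    (p : I -> {poly R}) (n : nat) :
  (\sum_(i <- r) p i)^`(n) = \sum_(i <- r) (p i)^`(n).
Proof. exact: linear_sum. Qed.

(** * Connection coefficients with second index zero *)

(** The coefficient of [P j] in [dpow ('X + a%:P) p], for every [j]: the junk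
    values [b p j] with [j > p] are cut off. *)
Definition dpow_coef (F : numFieldType) (b : nat -> nat -> F) (p j : nat) : F :=
  if (j <= p)%N then b p j / p`!%:R else 0.

Lemma dpow_coefE (F : numFieldType) (P : nat -> {poly F}) (a : F)
    (b : nat -> nat -> F)
    (bP : forall N : nat,
       ('X + a%:P) ^+ N = \sum_(0 <= k < N.+1) b N k *: P k)
    (N K : nat) : (N < K)%N ->
  dpow ('X + a%:P) N = \sum_(j < K) dpow_coef b N j *: P j.
Proof.
move=> NK; rewrite /dpow bP scaler_sumr.
rewrite (big_nat_widen _ _ K) // big_mkord.
rewrite [RHS](bigID (fun j : 'I_K => (j < N.+1)%N)) /=.
rewrite [X in _ + X]big1 ?addr0 => [|j /negPf]; last first.
  by rewrite ltnS /dpow_coef => ->; rewrite scale0r.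
by apply: eq_bigr => j; rewrite ltnS /dpow_coef => ->; rewrite scalerA mulrC.
Qed.

Lemma connection_coefficient0 (F : numFieldType) (P : nat -> {poly F})
    (degP : forall k : nat, size (P k) = k.+1) (a : F) (b : nat -> nat -> F)
    (bP : forall N : nat,
       ('X + a%:P) ^+ N = \sum_(0 <= k < N.+1) b N k *: P k)
    (gamma : nat -> nat -> nat -> nat -> F)
    (gammaP : forall N r s : nat, (r <= N)%N -> (P N)^`(r) =
      \sum_(0 <= k < (N - r).+1) gamma r s (N - r)%N k *: (P (k + s)%N)^`(s))
    (N r nu : nat) : (r <= N)%N ->
  gamma r (r + nu)%N (N - r)%N 0%N =
  \sum_(i < N.+1) (P N)^`(i).[- a] * dpow_coef b (i + nu) (r + nu).
Proof.
move=> rN; pose s := (r + nu)%N.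
pose c l := \sum_(i < N.+1) (P N)^`(i).[- a] * dpow_coef b (i + nu) l.
have dX : ('X + a%:P)^`() = 1 :> {poly F} by rewrite derivD derivX derivC addr0.
have PN : P N = (\sum_(i < N.+1)
    (P N)^`(i).[- a] *: dpow ('X + a%:P) (i + nu))^`(nu).
  rewrite derivn_sum [LHS](@taylor_dpow _ _ N.+1 (- a)) ?degP //=.
  apply: eq_bigr => i _.
  by rewrite derivnZ derivn_dpow // polyCN opprK.
(* The bound is [N + nu + 1], just above the largest divided power that occurs. *)
have PNc : P N = (\sum_(l < s + (N - r).+1) c l *: P l)^`(nu).
  rewrite [LHS]PN; congr (_^`(_)).
  under eq_bigr => i _.
    rewrite (dpow_coefE bP (K := (s + (N - r).+1)%N)); last first.
      by have := ltn_ord i; rewrite /s; lia.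
    rewrite scaler_sumr; over.
  rewrite exchange_big /=; apply: eq_bigr => l _.
  by rewrite /c scaler_suml; apply: eq_bigr => i _; rewrite scalerA.
have dnD (p : {poly F}) : p^`(nu)^`(r) = p^`(s) by rewrite /derivn -iterD.
have := @gammaP N r s rN; rewrite [in LHS]PNc dnD derivn_sum.
(* Terms with [l < s] die under [s] derivatives; the others, with [l = k + s], form a graded family,
   so coefficients can be compared, finally at [k = 0]. *)
rewrite big_split_ord /= big1 ?add0r => [|l _]; last first.
  by rewrite derivnZ derivn_poly0 ?scaler0 // degP; exact: ltn_ord.
under eq_bigr => k _ do rewrite derivnZ addnC.
rewrite big_mkord => /(@graded_sum_inj _ (fun k => (P (k + s)%N)^`(s)) _
  (fun k => c (k + s)%N) (fun k => gamma r s (N - r)%N k)) E.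
by rewrite -E // => k; exact: size_derivn_nat.
Qed.

(** * Rearranging double sums *)

Lemma sum_ord_widen0 (V : nmodType) (m K : nat) (f : nat -> V) :
  (m <= K)%N -> (forall i, (m <= i)%N -> f i = 0) ->
  \sum_(i < K) f i = \sum_(i < m) f i.
Proof.
move=> mK f0; rewrite -!(big_mkord xpredT f) (big_cat_nat _ mK) //=.
rewrite [X in _ + X]big_nat_cond [X in _ + X]big1 ?addr0 // => i.
by rewrite andbT => /andP[/f0].
Qed.

(** Raising [K] by one adds one entry to each row, and these entries form the new antidiagonal. *)
Lemma sum_antidiagonals (V : nmodType) (K : nat) (f : nat -> nat -> V) :
  \sum_(0 <= p < K.+1) \sum_(1 <= nu < p.+1) f (p - nu)%N (nu - 1)%N =
  \sum_(i < K) \sum_(k < K - i) f k i.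
Proof.
elim: K => [|K IH]; first by rewrite big_nat1 big_geq // big_ord0.
rewrite big_nat_recr //= {}IH big_add1 /= big_mkord.
rewrite [in RHS](eq_bigr (fun i : 'I_K.+1 =>
  \sum_(k < K - i) f k i + f (K - i)%N i)) => [|i _].
  rewrite [RHS]big_split /= [in RHS]big_ord_recr /= subnn big_ord0 addr0.
  by congr (_ + _); apply: eq_bigr => i _; rewrite subSS subn1.
by rewrite subSn ?big_ord_recr // -ltnS.
Qed.

(** The triangle [k + i <= m + n] contains the box supporting [f]. *)
Lemma sum_antidiagonals_box (V : nmodType) (m n : nat) (f : nat -> nat -> V) :
  (forall k i, (m < k)%N -> f k i = 0) -> (forall k i, (n < i)%N -> f k i = 0) ->
  \sum_(0 <= p < (m + n + 1).+1) \sum_(1 <= nu < p.+1)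
    f (p - nu)%N (nu - 1)%N = \sum_(k < m.+1) \sum_(i < n.+1) f k i.
Proof.
move=> fm fn; rewrite sum_antidiagonals exchange_big /=.
rewrite (@sum_ord_widen0 _ n.+1 _
  (fun i => \sum_(k < m + n + 1 - i) f k i)) => [|| i ni]; first last.
- by rewrite big1 // => k _; rewrite fn.
- by lia.
apply: eq_bigr => i _.
by rewrite (@sum_ord_widen0 _ m.+1 _ (f ^~ i)) => [//||k /fm ->//];
  have := ltn_ord i; lia.
Qed.

(** * The convolution as a double sum *)

Lemma segment_integral_convolution (R : realType) (p q : {poly R[i]})
    (a x : R[i]) (m n : nat) :
  (size p <= m)%N -> (size q <= n)%N ->
  segment_integral (fun t => p.[x - t] * q.[t]) (- a) (x + a) =
  \sum_(k < m) \sum_(i < n) p^`(k).[- a] * q^`(i).[- a] *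
    (dpow ('X + a%:P) (i + k).+1).[x + a].
Proof.
move=> pm qn; pose u : {poly R[i]} := 'X + a%:P; pose v := (x + a)%:P - 'X.
(* A primitive of the Taylor-expanded integrand: [u] vanishes at the lower endpoint [- a], [v] at
   the upper endpoint [x + a]. *)
pose Q := \sum_(k < m) \sum_(i < n)
  (p^`(k).[- a] * q^`(i).[- a]) *: beta_primitive u v i k.
have du : u^`() = 1 by rewrite derivD derivX derivC addr0.
have dv : v^`() = - 1 by rewrite derivB derivX derivC sub0r.
rewrite (@segment_integral_deriv _ _ Q) => [|t].
  rewrite /Q !horner_sum -sumrB; apply: eq_bigr => k _.
  rewrite !horner_sum -sumrB; apply: eq_bigr => i _.
  rewrite 2!hornerZ beta_primitive_end; last first.
    by rewrite hornerD hornerN hornerC hornerX subrr.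
  by rewrite beta_primitive_start ?mulr0 ?subr0 // hornerD hornerX hornerC addNr.
rewrite [in LHS](taylor_dpow (- a) pm) [in LHS](taylor_dpow (- a) qn).
rewrite !horner_sum mulr_suml /Q linear_sum /= horner_sum.
apply: eq_bigr => k _; rewrite linear_sum /= horner_sum mulr_sumr.
apply: eq_bigr => i _; rewrite derivZ deriv_beta_primitive //.
rewrite (hornerZ p^`(k).[- a]) (hornerZ q^`(i).[- a]) (hornerZ (_ * _)) hornerM.
rewrite !horner_dpow hornerXsubC /u /v !hornerD !hornerN !hornerC !hornerX.
by rewrite !opprK mulrACA [x - t + a]addrAC [X in _ * X = _]mulrC.
Qed.

Lemma convolution_coefficientsE (R : realType) (P : nat -> {poly R[i]})
    (degP : forall k : nat, size (P k) = k.+1)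
    (a : R[i]) (m n : nat)
    (b : nat -> nat -> R[i]) (bP : shifted_power_coefficients P a b)
    (rho : nat -> R[i]) (rhoP : convolution_coefficients P a m n rho) (j : nat) :
  (j <= m + n + 1)%N ->
  rho j = \sum_(k < m.+1) \sum_(i < n.+1)
    (P m)^`(k).[- a] * (P n)^`(i).[- a] * dpow_coef b (i + k).+1 j.
Proof.
move=> jmn; pose c j := \sum_(k < m.+1) \sum_(i < n.+1)
    (P m)^`(k).[- a] * (P n)^`(i).[- a] * dpow_coef b (i + k).+1 j.
rewrite -/(c j); apply: (graded_sum_inj degP (K := (m + n + 1).+1%N)) => //.
apply: horner_inj => y.
have := rhoP (y - a).
rewrite (@segment_integral_convolution _ _ _ _ _ m.+1 n.+1) ?degP //.
rewrite big_mkord subrK !horner_sum => E.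
under eq_bigr => l _ do rewrite hornerZ.
rewrite -{}E.
under [RHS]eq_bigr => l _.
  rewrite hornerZ /c mulr_suml; under eq_bigr => k _ do rewrite mulr_suml.
  over.
rewrite [RHS]exchange_big /=; apply: eq_bigr => k _.
rewrite [RHS]exchange_big /=; apply: eq_bigr => i _.
rewrite (dpow_coefE bP (K := (m + n + 1).+1%N)); last first.
  by have := ltn_ord i; have := ltn_ord k; lia.
rewrite horner_sum mulr_sumr; apply: eq_bigr => l _.
by rewrite hornerZ mulrA.
Qed.

Theorem theorem2p3 (R : realType) (P : nat -> {poly R[i]})
    (degP : forall k : nat, size (P k) = k.+1)
    (a : R[i]) (m n : nat)
    (gamma : nat -> nat -> nat -> nat -> R[i])
    (gammaP : connection_coefficients P gamma)
    (b : nat -> nat -> R[i]) (bP : shifted_power_coefficients P a b)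
    (rho : nat -> R[i]) (rhoP : convolution_coefficients P a m n rho) :
  [/\ forall j : nat, (j <= m + n + 1)%N ->
        rho j = \sum_(j <= p < (m + n + 1).+1) b p j / p`!%:R *
          \sum_(1 <= nu < p.+1)
            (P m)^`(p - nu).[- a] * (P n)^`(nu - 1).[- a],
      forall j : nat, (m + 1 <= j <= m + n + 1)%N ->
        rho j = \sum_(maxn 1 (j - n) <= nu < (m + 1).+1)
          gamma (j - nu)%N j (n + nu - j)%N 0%N * (P m)^`(nu - 1).[- a]
    & forall j : nat, (j <= m)%N ->
        rho j =
          \sum_(1 <= nu < j.+1)
            gamma (j - nu)%N j (m - j + nu)%N 0%N * (P n)^`(nu - 1).[- a] +
          \sum_(j.+1 <= nu < (n + 1).+1)
            (P n)^`(nu - 1).[- a] *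
            \sum_(0 <= p < m.+1)
              b (p + nu)%N j / (p + nu)`!%:R * (P m)^`(p).[- a]].
Proof.
have A0 k : (m < k)%N -> (P m)^`(k).[- a] = 0.
  by move=> mk; rewrite derivn_poly0 ?horner0 // degP.
have B0 i : (n < i)%N -> (P n)^`(i).[- a] = 0.
  by move=> ni; rewrite derivn_poly0 ?horner0 // degP.
have rhoE := convolution_coefficientsE degP bP rhoP.
have gammaE N r nu : (r <= N)%N -> _ :=
  @connection_coefficient0 _ P degP a b bP gamma gammaP N r nu.
split=> j jmn.
- rewrite rhoE // -(@sum_antidiagonals_box _ _ _ (fun k i =>
    (P m)^`(k).[- a] * (P n)^`(i).[- a] * dpow_coef b (i + k).+1 j)); first last.
  + by move=> k i ni; rewrite B0 // mulr0 mul0r.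
  + by move=> k i mk; rewrite A0 // !mul0r.
  (* Antidiagonals with [p < j] vanish by the cut-off in [dpow_coef]. *)
  rewrite (big_cat_nat (n := j)) //=; last lia.
  rewrite [X in X + _]big_nat big1 ?add0r => [|p pj].
    apply: eq_big_nat => p jp; rewrite mulr_sumr; apply: eq_big_nat => nu nup.
    have -> : (nu - 1 + (p - nu)).+1 = p by lia.
    by rewrite /dpow_coef ifT; [rewrite mulrC|lia].
  rewrite big_nat big1 // => nu nup.
  have -> : (nu - 1 + (p - nu)).+1 = p by lia.
  by rewrite /dpow_coef ifF; [rewrite mulr0|lia].
- pose T nu := (P m)^`(nu - 1).[- a] *
    \sum_(i < n.+1) (P n)^`(i).[- a] * dpow_coef b (i + nu) j.
  transitivity (\sum_(1 <= nu < (m + 1).+1) T nu).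
    rewrite rhoE; last lia.
    rewrite big_add1 /= big_mkord addn1; apply: eq_bigr => k _.
    rewrite /T subn1 mulr_sumr; apply: eq_bigr => i _.
    by rewrite addnS mulrA.
  (* For [nu < j - n] every index [i + nu] is below [j], so [T nu] vanishes. *)
  rewrite (big_cat_nat (n := maxn 1 (j - n)%N)) //=; [|lia|lia].
  rewrite [X in X + _]big_nat big1 ?add0r => [|nu nuj]; last first.
    rewrite /T big1 ?mulr0 // => i _.
    by rewrite /dpow_coef ifF; [rewrite mulr0|have := ltn_ord i; lia].
  apply: eq_big_nat => nu nuj.
  have := gammaE n (j - nu)%N nu; rewrite subnK; last lia.
  have -> : (n - (j - nu) = n + nu - j)%N by lia.
  by move=> -> //; [rewrite mulrC|lia].
- pose T nu := (P n)^`(nu - 1).[- a] *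
    \sum_(k < m.+1) (P m)^`(k).[- a] * dpow_coef b (k + nu) j.
  have T0 nu : (n.+1 < nu)%N -> T nu = 0.
    by move=> nnu; rewrite /T B0 ?mul0r //; lia.
  (* Padding the range by [j] terms, zero by [T0], allows a split at [j.+1] even when [j] exceeds
     [n + 1]. *)
  transitivity (\sum_(1 <= nu < (n + 1 + j).+1) T nu).
    rewrite rhoE; last lia.
    rewrite exchange_big big_add1 /= big_mkord.
    rewrite (@sum_ord_widen0 _ n.+1 _ (fun i => T i.+1)) => [|| i ni]; last 2 first.
    + lia.
    + exact: T0.
    apply: eq_bigr => i _; rewrite /T subn1 mulr_sumr.
    by apply: eq_bigr => k _; rewrite addnS addnC mulrCA mulrA.
  rewrite (big_cat_nat (n := j.+1)) //=; last lia.
  congr (_ + _).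
    apply: eq_big_nat => nu nuj.
    have := gammaE m (j - nu)%N nu; rewrite subnK; last lia.
    have -> : (m - (j - nu) = m - j + nu)%N by lia.
    by move=> -> //; [rewrite mulrC|lia].
  have [nj|jn] := leqP (n + 1).+1%N j.+1.
    rewrite [RHS]big_geq // big_nat big1 // => nu nuj.
    by rewrite T0 //; lia.
  rewrite (big_cat_nat (n := (n + 1).+1%N)) //=; [|lia|lia].
  rewrite [X in _ + X]big_nat [X in _ + X]big1 ?addr0 => [|nu nuj]; last first.
    by rewrite T0 //; lia.
  apply: eq_big_nat => nu nuj; rewrite /T big_mkord; congr (_ * _).
  by apply: eq_bigr => k _; rewrite mulrC /dpow_coef ifT; [|lia].
Qed.
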